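(* Let $n\ge 1$ and let $R_n(w)=\sum_{m=0}^{n}A_m w^m$ be a right quaternionic polynomial with coefficients $A_m\in\mathbb{H}$, $A_n\neq 0$. Let $\{w_1,\dots,w_n\}$ be a set of roots of $R_n$, taken with multiplicity. Then $$\sum_{m=1}^{n}\mathrm{Sc}(w_m)=-\frac{(A_n,A_{n-1})}{|A_n|^2}.$$
   Context: $\mathbb{H}=\{x_0+x_1i+x_2j+x_3k : x_0,\dots,x_3\in\mathbb{R}\}$ is the skew field of real quaternions, $i^2=j^2=k^2=-1$, $ij=-ji=k$, $jk=-kj=i$, $ki=-ik=j$. For $w=x_0+x_1i+x_2j+x_3k$ put $\mathrm{Sc}(w)=x_0$, $\mathrm{Vec}(w)=x_1i+x_2j+x_3k$, $\overline{w}=x_0-x_1i-x_2j-x_3k$, $|w|=\sqrt{x_0^2+x_1^2+x_2^2+x_3^2}$. The scalar product of $w$ and $v=y_0+y_1i+y_2j+y_3k$ is $(w,v)=\sum_{m=0}^{3}x_my_m$. Basic polynomial of $R_n$: the polynomial of a complex variable $$F^*_{2n}(z)=\sum_{m=0}^{2n}\Big(\sum_{d+r=m,\ 0\le d,r\le n}\overline{A}_dA_r\Big)z^m.$$ Its coefficients are real and its degree is $2n$. A root of $R_n$ is $w\in\mathbb{H}$ with $\sum_{m=0}^n A_mw^m=0$. A root $w$ with $|\mathrm{Vec}(w)|=r>0$ is spherical if every quaternion $w'$ with $\mathrm{Sc}(w')=\mathrm{Sc}(w)$ and $|\mathrm{Vec}(w')|=r$ is also a root; the whole sphere of such $w'$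 is then counted as one spherical root. The other roots are isolated. Multiplicity: the multiplicity of an isolated or spherical root $w$ of $R_n$ is the multiplicity, as a root of $F^*_{2n}$, of the complex number $z$ (equivalently $\overline{z}$) with $\mathrm{Re}\,z=\mathrm{Sc}(w)$, $|\mathrm{Im}\,z|=|\mathrm{Vec}(w)|$; if $z$ is real, the multiplicity of $w$ is half the multiplicity of $z$. Set of roots: a list $\{w_1,\dots,w_n\}$ containing each isolated root as many times as its multiplicity and, for each spherical root of multiplicity $k$, containing $k$ arbitrary quaternions chosen from that sphere. With multiplicity, the total number of roots is exactly $n$. *)

(* Defs.v *)
From HB Require Import structures.
From mathcomp Require Import all_boot all_order all_algebra.
From mathcomp Require Import ring.
From mathcomp Require Import reals complex.

Set Implicit Arguments.
Unset Strict Implicit.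
Unset Printing Implicit Defensive.

Import Order.TTheory GRing.Theory Num.Theory.
Local Open Scope ring_scope.

Record quat (R : realType) := Quat { q0 : R; q1 : R; q2 : R; q3 : R }.

Section QuatRing.
Variable R : realType.
Implicit Types w v : quat R.

Definition tuple_of_quat w := (q0 w, q1 w, q2 w, q3 w).
Definition quat_of_tuple (t : R * R * R * R) :=
  let: (a, b, c, d) := t in Quat a b c d.

Lemma tuple_of_quatK : cancel tuple_of_quat quat_of_tuple.
Proof. by case. Qed.

HB.instance Definition _ := Choice.copy (quat R) (can_type tuple_of_quatK).

Definition addH w v :=
  Quat (q0 w + q0 v) (q1 w + q1 v) (q2 w + q2 v) (q3 w + q3 v).
Definition oppH w := Quat (- q0 w) (- q1 w) (- q2 w) (- q3 w).

(* Bilinear extension of i^2 = j^2 = k^2 = -1, ij = -ji = k, jk = -kj = i,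
   ki = -ik = j, where (x0, x1, x2, x3) stands for x0 + x1 i + x2 j + x3 k. *)
Definition mulH w v :=
  Quat (q0 w * q0 v - q1 w * q1 v - q2 w * q2 v - q3 w * q3 v)
       (q0 w * q1 v + q1 w * q0 v + q2 w * q3 v - q3 w * q2 v)
       (q0 w * q2 v - q1 w * q3 v + q2 w * q0 v + q3 w * q1 v)
       (q0 w * q3 v + q1 w * q2 v - q2 w * q1 v + q3 w * q0 v).

Fact addHA : associative addH.
Proof. by move=> x y z; congr Quat; rewrite /= addrA. Qed.
Fact addHC : commutative addH.
Proof. by move=> x y; congr Quat; rewrite /= addrC. Qed.
Fact add0H : left_id (Quat 0 0 0 0) addH.
Proof. by case=> a b c d; congr Quat; rewrite /= add0r. Qed.
Fact addNH : left_inverse (Quat 0 0 0 0) oppH addH.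
Proof. by move=> x; congr Quat; rewrite /= addNr. Qed.

HB.instance Definition _ :=
  GRing.isZmodule.Build (quat R) addHA addHC add0H addNH.

Fact mulHA : associative mulH.
Proof. by move=> x y z; congr Quat; rewrite /=; ring. Qed.
Fact mul1H : left_id (Quat 1 0 0 0) mulH.
Proof. by case=> a b c d; congr Quat; rewrite /=; ring. Qed.
Fact mulH1 : right_id (Quat 1 0 0 0) mulH.
Proof. by case=> a b c d; congr Quat; rewrite /=; ring. Qed.
Fact mulHDl : left_distributive mulH addH.
Proof. by move=> x y z; congr Quat; rewrite /=; ring. Qed.
Fact mulHDr : right_distributive mulH addH.
Proof. by move=> x y z; congr Quat; rewrite /=; ring. Qed.
Fact oneH_neq0 : Quat 1 0 0 0 != 0 :> quat R.
Proof. by apply/eqP => -[] /eqP; rewrite oner_eq0. Qed.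

HB.instance Definition _ := GRing.Zmodule_isNzRing.Build (quat R)
  mulHA mul1H mulH1 mulHDl mulHDr oneH_neq0.

End QuatRing.

Section QuatPoly.
Variable R : realType.
Implicit Types (w v : quat R) (P : {poly quat R}).

Definition Sc w : R := q0 w.
Definition Vec w : quat R := Quat 0 (q1 w) (q2 w) (q3 w).
Definition conjH w : quat R := Quat (q0 w) (- q1 w) (- q2 w) (- q3 w).
Definition dotH w v : R :=
  q0 w * q0 v + q1 w * q1 v + q2 w * q2 v + q3 w * q3 v.
Definition normH w : R :=
  Num.sqrt (q0 w ^+ 2 + q1 w ^+ 2 + q2 w ^+ 2 + q3 w ^+ 2).

(* The polynomial A_0 + A_1 w + ... + A_n w^n, coefficients on the left of the
   powers, is P : {poly quat R} with A_m = P`_m and n = (size P).-1: over a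
   noncommutative ring, P.[w] is the sum of the P`_m * w ^+ m (horner_coef). *)

Definition basic_coef P (m : nat) : quat R :=
  \sum_(d < size P) \sum_(r < size P | (d + r == m)%N) conjH P`_d * P`_r.

Lemma Vec_basic_coef P m : Vec (basic_coef P m) = 0.
Proof.
have conjHD : {morph conjH : w v / w + v}.
  by move=> w v; congr Quat; rewrite /= opprD.
have conjH0 : conjH 0 = 0 by congr Quat; rewrite oppr0.
have conjHM w v : conjH (w * v) = conjH v * conjH w.
  by congr Quat; rewrite /=; ring.
have conjHK w : conjH (conjH w) = w by case: w => *; congr Quat; rewrite /= opprK.
have: conjH (basic_coef P m) = basic_coef P m.
  rewrite /basic_coef (big_morph _ conjHD conjH0).
  under eq_bigr => d _.
    rewrite (big_morph _ conjHD conjH0).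
    under eq_bigr => r _ do rewrite conjHM conjHK.
    over.
  rewrite (exchange_big_dep xpredT) //=.
  by apply: eq_bigr => r _; apply: eq_bigl => d; rewrite addnC.
case: (basic_coef P m) => a b c d [] /esym hb /esym hc /esym hd.
have z (x : R) : x = - x -> x = 0.
  by move/eqP; rewrite -subr_eq0 opprK -mulr2n mulrn_eq0 /= => /eqP.
by rewrite /Vec /= (z _ hb) (z _ hc) (z _ hd).
Qed.

(* F^*_{2n}; by Vec_basic_coef, taking scalar parts loses nothing. *)
Definition basic_poly P : {poly R[i]} :=
  \poly_(m < (2 * (size P).-1).+1) ((Sc (basic_coef P m))%:C)%C.

Definition same_sphere w w' : bool :=
  (Sc w' == Sc w) && (normH (Vec w') == normH (Vec w)).

Definition spherical_root P w : Prop :=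
  [/\ root P w, 0 < normH (Vec w) & forall w', same_sphere w w' -> root P w'].

Definition isolated_root P w : Prop := root P w /\ ~ spherical_root P w.

(* A real zero of F^*_{2n} has even multiplicity, as F^*_{2n} is nonnegative
   on the real axis, so the truncation in ./2 is harmless. *)
Definition root_mult P w : nat :=
  let z := (Sc w +i* normH (Vec w))%C in
  let k := mup z (basic_poly P) in
  if normH (Vec w) == 0 then k./2 else k.

(* A spherical root of multiplicity k contributes k arbitrary, possibly equal,
   points of its sphere. *)
Definition set_of_roots P (s : seq (quat R)) : Prop :=
  [/\ forall w, w \in s -> root P w,
      forall w, isolated_root P w -> count_mem w s = root_mult P w
    & forall w, spherical_root P w ->
        count (same_sphere w) s = root_mult P w].

End QuatPoly.

(* Main.v *)
Require Import Defs.
From mathcomp Require Import all_boot all_order all_algebra.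
From mathcomp Require Import reals complex.
From mathcomp Require Import boolp ring lra zify.

Set Implicit Arguments.
Unset Strict Implicit.
Unset Printing Implicit Defensive.

Import Order.TTheory GRing.Theory Num.Theory.
Local Open Scope ring_scope.

(** Let F be the basic polynomial of P, a complex polynomial of degree 2n with
    real coefficients. Its two leading coefficients are |A_n|^2 and
    2 (A_n, A_{n-1}) ([Sc_basic_coef_lead], [Sc_basic_coef_sublead]), so Vieta's
    formula gives - 2 (A_n, A_{n-1}) / |A_n|^2 for the sum of its 2n complex
    roots. On the other side, replace each root w of the given list by the pair
    z, conj z with z = Sc w + i |Vec w|; these 2n numbers have sum
    2 \sum Sc w. The theorem follows once the 2n numbers are known to be the
    roots of F with multiplicity.

    It suffices that none of them occurs more often than its multiplicity in F
    ([count_conj_pairs]): then \prod (X - z) divides F, and since both have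
    degree 2n they are proportional. That every root of F comes from a root of
    P, and that real roots of F have even multiplicity, is thus forced by the
    length n of the list.

    The bound on the occurrences comes from [count_sphere]: in the list, the
    entries on the sphere of w number exactly the multiplicity of w. This is
    part of the definition when w is spherical; when w is isolated, the point is
    that a sphere carrying two distinct roots consists of roots
    ([spherical_root_of_two]), so that w is the only entry on its sphere. *)

(** * Polynomials over a field and their multisets of roots *)

Lemma prod_XsubC_dvdp (F : fieldType) (rs : seq F) (p : {poly F}) :
    p != 0 -> (forall z, z \in rs -> (count_mem z rs <= mup z p)%N) ->
  \prod_(z <- rs) ('X - z%:P) %| p.
Proof.
elim: rs p => [|z rs IH] p p0 le_rs; first by rewrite big_nil dvd1p.
have: ('X - z%:P) %| p.
  by rewrite XsubC_dvd // (leq_trans _ (le_rs z _)) ?mem_head //= eqxx.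
case/dvdpP=> q def_p; rewrite big_cons def_p mulrC.
have q0 : q != 0 by apply: contraNneq p0 => q0; rewrite def_p q0 mul0r.
rewrite dvdp_mul2r ?polyXsubC_eq0 //; apply: IH => // y rs_y.
have := le_rs y; rewrite inE rs_y orbT /= => /(_ isT).
rewrite def_p mupM ?polyXsubC_eq0 //.
by rewrite -['X - z%:P]expr1 mup_XsubCX addnC; case: eqP => _; lia.
Qed.

(** Vieta's formula for the second coefficient, when [rs] is as long as the
    degree of [p]: the divisibility is then a proportionality. *)
Lemma coefPn_all_roots (F : fieldType) (rs : seq F) (p : {poly F}) n :
    \prod_(z <- rs) ('X - z%:P) %| p -> size p = n.+2 -> size rs = n.+1 ->
  p`_n = - (p`_n.+1 * \sum_(z <- rs) z).
Proof.
move=> dv sp srs; set g := \prod_(z <- rs) _ in dv.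
have sg : size g = n.+2 by rewrite /g size_prod_XsubC srs.
have : p %= g by rewrite eqp_sym -dvdp_size_eqp // sg sp.
case/eqpf_eq=> c c0 ->.
have gn1 : g`_n.+1 = 1.
  by have := monic_prod_XsubC rs xpredT id; rewrite monicE lead_coefE -/g sg => /eqP.
have gn : g`_n = - \sum_(z <- rs) z.
  by rewrite -coefPn_prod_XsubC ?srs.
by rewrite !coefZ gn gn1 mulr1 mulrN.
Qed.

Lemma mup_map_poly (F L : fieldType) (f : {rmorphism F -> L}) (p : {poly F}) z :
  p != 0 -> mup (f z) (map_poly f p) = mup z p.
Proof.
move=> p0; have fp0 : map_poly f p != 0 by rewrite map_poly_eq0.
have ge k : (k <= mup (f z) (map_poly f p))%N = (k <= mup z p)%N.
  rewrite (mup_geq _ _ fp0) (mup_geq _ _ p0) -(dvdp_map f).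
  by rewrite rmorphXn rmorphB /= map_polyX map_polyC.
by apply/eqP; rewrite eqn_leq -ge leqnn ge leqnn.
Qed.

(** * Zeros of a quaternionic polynomial on a sphere *)

Section Quat.
Variable R : realType.
Implicit Types (v w : quat R) (P : {poly quat R}) (s : seq (quat R)).

Lemma sqr_normH w :
  normH w ^+ 2 = q0 w ^+ 2 + q1 w ^+ 2 + q2 w ^+ 2 + q3 w ^+ 2.
Proof. by rewrite sqr_sqrtr // !addr_ge0 ?sqr_ge0. Qed.

Lemma normH_ge0 w : 0 <= normH w.
Proof. exact: sqrtr_ge0. Qed.

Lemma normH_eq0 w : (normH w == 0) = (w == 0).
Proof.
apply/eqP/eqP => [w0|->]; last by rewrite /normH /= expr0n /= !addr0 sqrtr0.
have := sqr_normH w; rewrite w0 expr0n /=; case: w {w0} => a b c d /= h.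
have [ha hb hc hd] := And4 (sqr_ge0 a) (sqr_ge0 b) (sqr_ge0 c) (sqr_ge0 d).
have e x : x ^+ 2 = 0 -> x = 0 :> R by move/eqP; rewrite sqrf_eq0 => /eqP.
by congr Quat; apply: e; lra.
Qed.

Lemma mul_conjH w : w * conjH w = Quat (normH w ^+ 2) 0 0 0.
Proof. by rewrite sqr_normH; congr Quat; rewrite /=; ring. Qed.

(** Multiply on the right by conj w: w * conj w is the positive real |w|^2. *)
Lemma mulH_eq0 v w : v * w = 0 -> w != 0 -> v = 0.
Proof.
move=> vw0; rewrite -normH_eq0 -sqrf_eq0 => nz.
have := congr1 (fun u => u * conjH w) vw0.
rewrite mul0r -mulrA mul_conjH; move: (normH w ^+ 2) nz => N nz.
case: v vw0 => a b c d _ [].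
rewrite !mulr0 !addr0 !subr0 !add0r ?oppr0 ?addr0 ?add0r => ha hb hc hd.
have e x : x * N = 0 -> x = 0.
  by move/eqP; rewrite mulf_eq0 (negPf nz) orbF => /eqP.
by rewrite (e _ ha) (e _ hb) (e _ hc) (e _ hd).
Qed.

(** All points of a sphere are zeros of the same real quadratic polynomial
    X^2 - 2 (Sc w) X + |w|^2. *)
Lemma sphere_sqr w v : same_sphere w v ->
  v * v = Quat (2 * Sc w) 0 0 0 * v - Quat (normH w ^+ 2) 0 0 0.
Proof.
case/andP=> /eqP sc /eqP /(congr1 (fun x => x ^+ 2)) vec.
have -> : normH w ^+ 2 = normH v ^+ 2.
  by move: vec sc; rewrite !sqr_normH /Sc /= => vec ->; lra.
by rewrite -sc /Sc sqr_normH; congr Quat; rewrite /=; ring.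
Qed.

(** Reducing P modulo the real, hence central, quadratic polynomial of the
    sphere leaves a remainder A X + B of degree at most 1. *)
Lemma horner_sphere P w :
  exists A B, forall v, same_sphere w v -> P.[v] = A * v + B.
Proof.
elim/poly_ind: P => [|P c [A [B PE]]].
  by exists 0, 0 => v _; rewrite horner0 mul0r addr0.
exists (A * Quat (2 * Sc w) 0 0 0 + B), (c - A * Quat (normH w ^+ 2) 0 0 0).
move=> v wv; rewrite hornerMXaddC PE // mulrDl -mulrA (sphere_sqr wv).
rewrite mulrBr [in RHS]mulrDl !mulrA -!addrA; congr (_ + _).
by rewrite addrC -addrA.
Qed.

Lemma same_sphere_refl w : same_sphere w w.
Proof. by rewrite /same_sphere !eqxx. Qed.

(** An affine function v |-> A v + B with two distinct zeros has A = 0, since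
    there are no zero divisors, and then B = 0: P vanishes on the sphere. *)
Lemma spherical_root_of_two P w v :
    same_sphere w v -> v != w -> root P w -> root P v -> spherical_root P w.
Proof.
move=> wv vw rw rv; have [A [B PE]] := horner_sphere P w.
have A0 : A = 0.
  apply: (@mulH_eq0 A (v - w)); last by rewrite subr_eq0.
  rewrite mulrBr -[A * v](addrK B) -[A * w](addrK B) -!PE ?same_sphere_refl //.
  by rewrite (rootP rv) (rootP rw) subrr.
have B0 : B = 0.
  by rewrite -(rootP rw) PE ?same_sphere_refl // A0 mul0r add0r.
split; [exact: rw | | by move=> u wu; apply/rootP; rewrite PE // A0 B0 mul0r addr0].
rewrite lt_def normH_ge0 andbT; apply: contraNneq vw => w0.
have real u : same_sphere w u -> u = Quat (Sc w) 0 0 0.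
  case/andP=> /eqP <-; rewrite w0 normH_eq0 => /eqP[].
  by case: u => a b c d /= -> -> ->.
by rewrite (real v) // [in X in _ == X](real w) // same_sphere_refl.
Qed.

(** * Spheres as complex numbers *)

(** The choice of the conjugate in the closed upper half plane makes this
    injective on spheres. *)
Definition sphere_rep w : R[i] := (Sc w +i* normH (Vec w))%C.

Lemma sphere_rep_eq w v : (sphere_rep v == sphere_rep w) = same_sphere w v.
Proof. by rewrite eq_complex. Qed.

(** Two points of the closed upper half plane are conjugate only if they are
    equal and real; this is what doubles the count at real roots. *)
Lemma conj_sphere_rep_eq w v :
  (conjc (sphere_rep v) == sphere_rep w) =
    (normH (Vec w) == 0) && same_sphere w v.
Proof.
rewrite eq_complex /same_sphere /= andbCA; congr (_ && _).
have := normH_ge0 (Vec w); have := normH_ge0 (Vec v).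
move: (normH _) (normH _) => x y x0 y0.
by apply/eqP/andP => [xy|[/eqP-> /eqP->]]; [split; apply/eqP; lra | rewrite oppr0].
Qed.

(** An isolated w is the only entry of its sphere, because another one would
    make it spherical by [spherical_root_of_two]. *)
Lemma count_sphere P s w : set_of_roots P s -> w \in s ->
  count (same_sphere w) s = root_mult P w.
Proof.
case=> roots iso sph sw.
have [/sph//|nsph] := EM (spherical_root P w).
rewrite -iso; last by split=> //; exact: roots.
apply: eq_in_count => v sv /=; apply/idP/eqP => [wv|->]; last first.
  exact: same_sphere_refl.
apply: contrapT => /eqP vw; apply: nsph.
by apply: spherical_root_of_two wv vw _ _; apply: roots.
Qed.

(** * The basic polynomial *)

Lemma map_conjc_basic_poly P : map_poly conjc (basic_poly P) = basic_poly P.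
Proof.
apply/polyP => i; rewrite coef_map coef_poly /=.
by case: ifP => _; rewrite ?conjc0 // conjc_real.
Qed.

Lemma mup_basic_poly_conjc P z : basic_poly P != 0 ->
  mup (conjc z) (basic_poly P) = mup z (basic_poly P).
Proof.
by move=> p0; rewrite -[in LHS]map_conjc_basic_poly (mup_map_poly _ _ p0).
Qed.

Lemma Sc_sum (I : Type) (r : seq I) (Q : pred I) (F : I -> quat R) :
  Sc (\sum_(i <- r | Q i) F i) = \sum_(i <- r | Q i) Sc (F i).
Proof.
have ScD : {morph Sc (R := R) : u v / u + v} by [].
exact: (big_morph _ ScD erefl).
Qed.

Lemma Sc_conj_mul w v : Sc (conjH w * v) = dotH w v.
Proof. by rewrite /Sc /dotH /=; ring. Qed.

Lemma dotHC w v : dotH w v = dotH v w.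
Proof. by rewrite /dotH; ring. Qed.

Lemma dotHH w : dotH w w = normH w ^+ 2.
Proof. by rewrite sqr_normH /dotH; ring. Qed.

Lemma Sc_basic_coef_lead P n : size P = n.+1 ->
  Sc (basic_coef P (2 * n)) = normH P`_n ^+ 2.
Proof.
move=> sP; rewrite /basic_coef sP Sc_sum big_ord_recr /= big1 => [|i _].
  rewrite Sc_sum (big_pred1 ord_max) ?add0r ?Sc_conj_mul ?dotHH //.
  by move=> j /=; rewrite -val_eqE /=; lia.
by rewrite big_pred0 // => j; have := ltn_ord i; have := ltn_ord j; lia.
Qed.

Lemma Sc_basic_coef_sublead P n : size P = n.+2 ->
  Sc (basic_coef P (2 * n).+1) = 2 * dotH P`_n.+1 P`_n.
Proof.
move=> sP; rewrite /basic_coef sP Sc_sum !big_ord_recr /= big1 => [|i _].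
  (* The only terms are (d, r) = (n, n + 1) and (n + 1, n). *)
  rewrite !Sc_sum (big_pred1 ord_max) => [|j /=]; last by rewrite -val_eqE /=; lia.
  rewrite (big_pred1 (widen_ord (leqnSn _) ord_max)) => [|j /=]; last first.
    by rewrite -val_eqE /=; lia.
  by rewrite add0r !Sc_conj_mul /= dotHC mulrDl !mul1r.
by rewrite big_pred0 // => j; have := ltn_ord i; have := ltn_ord j; lia.
Qed.

Lemma size_basic_poly P n : size P = n.+1 -> size (basic_poly P) = (2 * n).+1.
Proof.
move=> sP; rewrite /basic_poly size_poly_eq sP //= Sc_basic_coef_lead //.
rewrite fmorph_eq0 sqrf_eq0 normH_eq0.
by have := lead_coef_eq0 P; rewrite lead_coefE sP /= => ->; rewrite -size_poly_eq0 sP.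
Qed.

(** * Comparison of the list of roots with the roots of the basic polynomial *)

Definition conj_pairs s : seq R[i] :=
  map sphere_rep s ++ map (conjc \o sphere_rep) s.

Lemma count_conj_pairs_conjc s z :
  count_mem (conjc z) (conj_pairs s) = count_mem z (conj_pairs s).
Proof.
have conjc_eq (x y : R[i]) : (conjc x == conjc y) = (x == y).
  exact: (inj_eq (can_inj (@conjcK R))).
rewrite /conj_pairs !count_cat addnC !count_map; congr (_ + _)%N.
  by apply: eq_count => w; exact: conjc_eq.
apply: eq_count => w; rewrite -[z in RHS]conjcK; exact/esym/conjc_eq.
Qed.

(** At z not real, only one of the two conjugates of each pair can be z, and
    the count is the multiplicity k. At z real, each entry w = z counts twice, so
    the total is 2 * (k./2) <= k. *)
Lemma count_conj_pairs P s z : set_of_roots P s -> basic_poly P != 0 ->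
  z \in conj_pairs s -> (count_mem z (conj_pairs s) <= mup z (basic_poly P))%N.
Proof.
move=> Ps p0 sz.
(* Neither side changes when z is conjugated, so z may be taken in the closed
   upper half plane. *)
wlog [w sw ->] : z sz / exists2 w, w \in s & z = sphere_rep w.
  move: (sz); rewrite mem_cat => /orP[] /mapP[w sw ->] wlog_hyp.
    by apply: wlog_hyp; [rewrite mem_cat map_f | exists w].
  rewrite -[(conjc \o _) w]/(conjc (sphere_rep w)).
  rewrite count_conj_pairs_conjc (mup_basic_poly_conjc _ p0).
  by apply: wlog_hyp; [rewrite mem_cat map_f | exists w].
rewrite count_cat !count_map; set k := mup _ _.
have -> : count (preim sphere_rep (pred1 (sphere_rep w))) s = root_mult P w.
  rewrite -(count_sphere Ps sw).
  by apply: eq_count => v /=; rewrite sphere_rep_eq.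
rewrite (eq_count (conj_sphere_rep_eq w)) /root_mult -/(sphere_rep w) -/k.
case: ifP => w0; last by rewrite (eq_count (a2 := pred0)) ?count_pred0 ?addn0.
rewrite (eq_count (a2 := same_sphere w)) // (count_sphere Ps sw) /root_mult.
by rewrite w0 -/(sphere_rep w) -/k; lia.
Qed.

Lemma sum_conj_pairs s :
  \sum_(z <- conj_pairs s) z = ((2 * \sum_(w <- s) Sc w)%:C)%C.
Proof.
rewrite big_cat /= !big_map -big_split /= mulr_sumr rmorph_sum; apply: eq_bigr => w _.
by rewrite /= addcJ rmorphM rmorph_nat.
Qed.

End Quat.

Theorem theorem4 (R : realType) (n : nat) (hn : (1 <= n)%N)
    (P : {poly quat R}) (hP : size P = n.+1)
    (w : n.-tuple (quat R)) (hw : set_of_roots P w) :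
  \sum_(m < n) Sc (tnth w m) =
    - (dotH P`_n P`_n.-1 / normH P`_n ^+ 2).
Proof.
case: n hn P hP w hw => // n _ P sP w Pw.
have sF := size_basic_poly sP.
have F0 : basic_poly P != 0 by rewrite -size_poly_eq0 sF.
have dvF : \prod_(z <- conj_pairs w) ('X - z%:P) %| basic_poly P.
  apply: prod_XsubC_dvdp => // z; exact: count_conj_pairs.
have e2 : (2 * n.+1 = (2 * n).+2)%N by lia.
have := coefPn_all_roots dvF (etrans sF (congr1 S e2)).
rewrite size_cat !size_map size_tuple addnn -mul2n => /(_ e2).
rewrite !coef_poly sP /= e2 ltnS leqnn leqnSn Sc_basic_coef_sublead //.
rewrite -e2 Sc_basic_coef_lead // sum_conj_pairs -rmorphM -rmorphN.
move=> /(fmorph_inj (real_complex R)) main.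
have nz : normH P`_n.+1 ^+ 2 != 0.
  rewrite sqrf_eq0 normH_eq0; have := lead_coef_eq0 P.
  by rewrite lead_coefE sP /= => ->; rewrite -size_poly_eq0 sP.
rewrite -(big_tuple _ _ w xpredT (@Sc R)).
by apply: (mulfI nz); rewrite mulrN mulrCA mulfV // mulr1; lra.
Qed.
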